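(* Let $\Gamma=\Gamma(R,G,B)$ be a combinatorial map, with red edges $R$, green edges $G$ and black edges $B$. Let $E$ be the set of red-green quadrilaterals of $\Gamma$ (the $4$-cycles making up $R\cup G$). Let $\mathcal{F}$ be the collection of all subsets $F\subseteq E$ for which there is a fully black Hamiltonian cycle $C$ of $\Gamma$ such that $F$ is exactly the set of quadrilaterals $q\in E$ whose pair of green edges is contained in $C$. Then $(E,\mathcal{F})$ is a $\Delta$-matroid.
   Context: A combinatorial map (or map graph) $\Gamma(R,G,B)$ is a finite connected graph $\Gamma$ (parallel edges allowed) whose edge set is partitioned into three classes $R$ (red), $G$ (green), $B$ (black) such that each class is a perfect matching of $\Gamma$ and $R\cup G$ is a disjoint union of $4$-cycles (so each quadrilateral has two opposite red edges and two opposite green edges). A subgraph is called fully black if it contains all black edges of $\Gamma$. A fully black $2$-regular subgraph, in particular a fully black Hamiltonian cycle, meets each red-green quadrilateral in either exactly its two red edges or exactly its two green edges. A $\Delta$-matroid is a finite set $E$ with a collection $\mathcal{F}$ of subsets of $E$ (the feasible sets) satisfying the symmetric exchange axiom: if $F_1,F_2\in\mathcal{F}$ and $x\in F_1\bigtriangleup F_2$, then there exists $y\in F_1\bigtriangleup F_2$ (possibly $y=x$) such that $F_1\bigtriangleup\{x,y\}\in\mathcal{F}$. Here $\bigtriangleup$ denotes symmetric difference. *)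

(* Defs.v *)
From mathcomp Require Import all_boot.

Set Implicit Arguments.
Unset Strict Implicit.
Unset Printing Implicit Defensive.

(** * Multigraphs *)

(* Edges are abstract objects, so distinct edges may have the same ends;
   loops are excluded. *)
Record multigraph := Multigraph {
  vertex : finType;
  edge : finType;
  ends : edge -> {set vertex};
  card_ends : forall e, #|ends e| = 2
}.

Definition adjacent (Gm : multigraph) : rel (vertex Gm) :=
  fun u v => [exists e : edge Gm, ends e == [set u; v]].

Definition connected_graph (Gm : multigraph) : Prop :=
  forall u v : vertex Gm, connect (@adjacent Gm) u v.

(* Subgraphs without isolated vertices are represented by their edge sets;
   [vertices_of] recovers the vertex set. *)
Definition vertices_of (Gm : multigraph) (C : {set edge Gm}) :
    {set vertex Gm} :=
  \bigcup_(e in C) ends e.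

(* C = {e_0, ..., e_(n-1)} with n = #|C| > 0, where e_i joins v_i to
   v_(i+1 mod n) and the vertices v_0, ..., v_(n-1) are pairwise distinct.
   The e_i are then distinct, since there are n of them and they exhaust C. *)
Definition is_cycle (Gm : multigraph) (C : {set edge Gm}) : bool :=
  (C != set0) &&
  [exists v : {ffun 'I_#|C| -> vertex Gm},
   [exists e : {ffun 'I_#|C| -> edge Gm},
     [&& injectiveb v,
         C == [set e i | i : 'I_#|C|]
       & [forall i, ends (e i) == [set v i; v (ordS i)]]]]].

Definition is_hamiltonian_cycle (Gm : multigraph) (C : {set edge Gm}) : bool :=
  is_cycle C && (vertices_of C == [set: vertex Gm]).

Definition perfect_matching (Gm : multigraph) (M : {set edge Gm}) : Prop :=
  forall v : vertex Gm, #|[set e in M | v \in ends e]| = 1.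

Definition four_cycles (Gm : multigraph) (D : {set edge Gm}) :
    {set {set edge Gm}} :=
  [set q : {set edge Gm} | [&& q \subset D, is_cycle q & #|q| == 4]].

Definition disjoint_union_of_four_cycles (Gm : multigraph)
    (D : {set edge Gm}) : Prop :=
  cover (four_cycles D) = D /\
  {in four_cycles D &, forall q q' : {set edge Gm},
    q != q' -> [disjoint vertices_of q & vertices_of q']}.

(** * Combinatorial maps *)

Definition combinatorial_map (Gm : multigraph) (R G B : {set edge Gm}) : Prop :=
  [/\ connected_graph Gm,
      [/\ R :|: G :|: B = [set: edge Gm],
          [disjoint R & G], [disjoint R & B] & [disjoint G & B]],
      [/\ perfect_matching R, perfect_matching G & perfect_matching B]
    & disjoint_union_of_four_cycles (R :|: G)].

Definition quadrilaterals (Gm : multigraph) (R G : {set edge Gm}) :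
    {set {set edge Gm}} :=
  four_cycles (R :|: G).

Definition fully_black (Gm : multigraph) (B C : {set edge Gm}) : bool :=
  B \subset C.

(* [q :&: G] is the pair of green edges of the quadrilateral [q]. *)
Definition green_quadrilaterals (Gm : multigraph) (R G C : {set edge Gm}) :
    {set {set edge Gm}} :=
  [set q in quadrilaterals R G | q :&: G \subset C].

Definition map_feasible (Gm : multigraph) (R G B : {set edge Gm}) :
    {set {set {set edge Gm}}} :=
  [set F : {set {set edge Gm}} |
    (F \subset quadrilaterals R G) &&
    [exists C : {set edge Gm},
      [&& is_hamiltonian_cycle C, fully_black B C
        & F == green_quadrilaterals R G C]]].

(** * Delta-matroids *)

Definition symdiff (T : finType) (A B : {set T}) : {set T} :=
  (A :\: B) :|: (B :\: A).

(* The family of feasible sets is not required to be nonempty. *)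
Definition delta_matroid (T : finType) (E : {set T}) (F : {set {set T}}) :
    Prop :=
  F \subset powerset E /\
  forall F1 F2 : {set T}, F1 \in F -> F2 \in F ->
  forall x : T, x \in symdiff F1 F2 ->
  exists2 y : T, y \in symdiff F1 F2 & symdiff F1 [set x; y] \in F.

(* Main.v *)
Require Import Defs.
From mathcomp Require Import all_boot.

(** Let C1, C2 be fully black Hamiltonian cycles with feasible sets F1, F2, and
    let x be a quadrilateral on which they differ. Exchanging the colours of C1
    in x means replacing C1 by H, the symmetric difference of C1 and x; this is
    again a 2-regular fully black subgraph. If H is connected, take y = x.
    Otherwise H has exactly two components K and K'. Were every quadrilateral
    of F1 symdiff F2 other than x contained in one of them, no edge of C2 would
    join K to K', since outside these quadrilaterals C2 agrees with H; so some
    such y meets both, and exchanging colours in y merges K with K'.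

    Components are counted by parity: in a set of vertices that no edge of
    C minus q leaves, the black matching shows that the number of vertices is
    even, and the other matching that the number of vertices off q is even, so
    the set contains an even number of the four vertices of q. *)

Set Implicit Arguments.
Unset Strict Implicit.
Unset Printing Implicit Defensive.

(** * Symmetric differences and fixed-point-free involutions *)

Lemma mem_symdiff (T : finType) (A B : {set T}) z :
  (z \in symdiff A B) = (z \in A) (+) (z \in B).
Proof. by rewrite !inE; case: (z \in A); case: (z \in B). Qed.

(** The pairs [x], [f x] partition [K]; the induction removes one pair at a time. *)
Lemma involution_even (T : finType) (f : T -> T) (K : {set T}) :
  involutive f -> (forall x, f x != x) -> (forall x, x \in K -> f x \in K) ->
  ~~ odd #|K|.
Proof.
move=> fK f_neq; have [n] := ubnP #|K|; elim: n K => // n IHn K ltKn fS.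
have [->|[x xK]] := set_0Vmem K; first by rewrite cards0.
have fxK : f x \in K :\ x by rewrite !inE f_neq fS.
rewrite (cardsD1 x) xK (cardsD1 (f x)) fxK /= negbK.
apply: IHn => [|y].
  by rewrite -ltnS (leq_trans _ ltKn) // !ltnS [#|K|](cardsD1 x) xK
    (cardsD1 (f x) (K :\ x)) fxK.
rewrite !inE => /and3P[y_fx y_x yK]; rewrite fS // andbT.
by rewrite (inj_eq (inv_inj fK)) y_x (inv_eq fK).
Qed.

(** * Saturated vertex sets and perfect matchings *)

Section Graph.

Variable Gm : multigraph.
Implicit Types (C D M : {set edge Gm}) (K L Q : {set vertex Gm}).

(* K is a union of components of the graph (V, C); stating connectivity through
   such sets avoids paths. *)
Definition saturated C K :=
  forall e u v, e \in C -> u \in ends e -> v \in ends e ->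
  (u \in K) = (v \in K).

(** [K] ranges over sets of arbitrary vertices, so a vertex missed by [C] counts as a component of
    its own. *)
Definition cut_connected C :=
  forall K, saturated C K -> K = set0 \/ K = setT.

(** By finiteness saturation is decidable, so failure of connectedness yields an explicit separating
    set without classical axioms. *)
Lemma cut_connectedVcut C :
  cut_connected C \/ exists K, [/\ saturated C K, K <> set0 & K <> setT].
Proof.
have satP K : reflect (saturated C K) [forall e in C,
    [forall u in ends e, [forall v in ends e, (u \in K) == (v \in K)]]].
  apply: (iffP forall_inP) => [sat e u v eC ue ve|sat e eC].
    by have /forall_inP/(_ u ue)/forall_inP/(_ v ve)/eqP := sat e eC.
  by apply/forall_inP=> u ue; apply/forall_inP=> v ve; apply/eqP/(sat e).
have [/forallP con|] := boolP [forall K : {set vertex Gm},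
    [forall e in C,
      [forall u in ends e, [forall v in ends e, (u \in K) == (v \in K)]]]
    ==> (K == set0) || (K == setT)].
  left=> K /satP satK; have := con K; rewrite satK => /orP[]/eqP->;
  by [left | right].
case/forallPn => K; rewrite negb_imply negb_or => /and3P[/satP satK].
by move=> /eqP K0 /eqP KT; right; exists K.
Qed.

Lemma saturated_sub C D K : C \subset D -> saturated D K -> saturated C K.
Proof. by move=> /subsetP sCD satK e u v /sCD; apply: satK. Qed.

Lemma saturatedU C D K :
  saturated C K -> saturated D K -> saturated (C :|: D) K.
Proof. by move=> sC sD e u v /setUP[]; [apply: sC | apply: sD]. Qed.

Lemma saturatedC C K : saturated C K -> saturated C (~: K).
Proof. by move=> sK e u v Ce ue ve; rewrite !inE (sK e u v). Qed.

Lemma saturatedI C K L :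
  saturated C K -> saturated C L -> saturated C (K :&: L).
Proof. by move=> sK sL e u v Ce ue ve; rewrite !inE (sK e u v) ?(sL e u v). Qed.

Lemma edge_vertex (e : edge Gm) : exists v, v \in ends e.
Proof. by apply/set0Pn; rewrite -card_gt0 card_ends. Qed.

Lemma other_end e (v : vertex Gm) :
  v \in ends e -> exists2 w, w != v & ends e = [set v; w].
Proof.
move=> ve; have := card_ends e; rewrite (cardsD1 v) ve => -[] /eqP.
case/cards1P => w Ew; exists w.
  by have: w \in ends e :\ v by [rewrite Ew set11]; rewrite !inE => /andP[].
by rewrite -(setD1K ve) Ew.
Qed.

(** Turns a matching into functions: [f] gives the partner of a vertex and [g] the matching edge
    there. Both the parity count and the alternating walk use this form. *)
Lemma matching_mate M : perfect_matching M ->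
  exists f, exists g, [/\ involutive f, (forall v, f v != v),
    (forall v, g v \in M), (forall v, ends (g v) = [set v; f v])
  & forall v e, e \in M -> v \in ends e -> e = g v].
Proof.
move=> pM.
have /fin_all_exists[g gP] v :
  exists e, forall e', ((e' \in M) && (v \in ends e')) = (e' == e).
  have /eqP/cards1P[e /setP Ee] := pM v.
  by exists e => e'; move: (Ee e'); rewrite !inE.
have gM v : (g v \in M) && (v \in ends (g v)) by rewrite gP.
have /fin_all_exists2[f f_neq fE] v :
    exists2 w, w != v & ends (g v) = [set v; w].
  by apply: other_end; case/andP: (gM v).
have gU v e : e \in M -> v \in ends e -> e = g v.
  by move=> Me ve; apply/eqP; rewrite -gP Me.
exists f, g; split=> // [v|v]; last by case/andP: (gM v).
have Eg : g v = g (f v).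
  by apply: gU; [case/andP: (gM v) | rewrite fE !inE eqxx orbT].
have: f (f v) \in ends (g v) by rewrite Eg fE !inE eqxx orbT.
by rewrite fE !inE (negPf (f_neq (f v))) orbF => /eqP.
Qed.

Lemma matching_even M K : perfect_matching M ->
    (forall v e, e \in M -> v \in ends e -> v \in K ->
       forall w, w \in ends e -> w \in K) ->
  ~~ odd #|K|.
Proof.
move=> /matching_mate[f [g [fI f_neq gM gE _]]] cK.
apply: (involution_even fI f_neq) => v vK.
by apply: (cK v (g v)); rewrite ?gM // gE !inE eqxx ?orbT.
Qed.

(** * Size, connectedness and degrees of a cycle *)

Section CycleFacts.

Variable C : {set edge Gm}.
Hypothesis cycC : is_cycle C.

Lemma cycle_param : exists n, exists v : 'I_n.+1 -> vertex Gm,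
  exists e : 'I_n.+1 -> edge Gm,
  [/\ n.+1 = #|C|, injective v, injective e,
      C = [set e i | i : 'I_n.+1]
    & forall i, ends (e i) = [set v i; v (ordS i)]].
Proof.
case/andP: cycC => C0 /existsP[v /existsP[e /and3P[/injectiveP v_inj]]].
move=> /eqP EC /forallP eE.
move: v e v_inj EC eE; case En: #|C| => [|n] v e v_inj EC eE.
  by rewrite (cards0_eq En) eqxx in C0.
exists n, v, e; split=> //; last by move=> i; apply/eqP.
(* The [n.+1] indices exhaust a set of [n.+1] edges, so no edge is repeated. *)
have /imset_injP ei : #|[set e i | i : 'I_n.+1]| == #|'I_n.+1|.
  by rewrite -EC En card_ord.
by move=> i j; apply: ei.
Qed.

Lemma cycle_vertices_card : #|vertices_of C| = #|C|.
Proof.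
have [n [v [e [En v_inj e_inj EC eE]]]] := cycle_param.
rewrite -En -[RHS]card_ord -cardsT -(card_imset _ v_inj).
apply: eq_card => w; apply/bigcupP/imsetP => [[d]|[i _ ->]].
  rewrite EC => /imsetP[i _ ->]; rewrite eE !inE => /orP[]/eqP->.
    by exists i.
  by exists (ordS i).
by exists (e i); [rewrite EC imset_f | rewrite eE !inE eqxx].
Qed.

Lemma cycle_connected K : saturated C K ->
  {in vertices_of C &, forall u v, (u \in K) = (v \in K)}.
Proof.
have [n [v [e [En v_inj e_inj EC eE]]]] := cycle_param => satK.
have step i : (v (ordS i) \in K) = (v i \in K).
  by apply: (satK (e i)); rewrite ?EC ?imset_f // eE !inE eqxx ?orbT.
have base i : (v i \in K) = (v ord0 \in K).
  case: i => m; elim: m => [|m IHm] lt_m.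
    by congr (v _ \in K); apply: val_inj.
  have -> : Ordinal lt_m = ordS (Ordinal (ltnW lt_m)).
    by apply: val_inj; rewrite /= modn_small.
  by rewrite step IHm.
suff H u : u \in vertices_of C -> (u \in K) = (v ord0 \in K).
  by move=> x y /H-> /H->.
case/bigcupP => d; rewrite {1}EC => /imsetP[i _ ->].
by rewrite eE !inE => /orP[]/eqP->.
Qed.

Lemma cycle_degree w :
  w \in vertices_of C -> #|[set e in C | w \in ends e]| = 2.
Proof.
have [n [v [e [En v_inj e_inj EC eE]]]] := cycle_param => wC.
have [i ->] : exists i, w = v i.
  case/bigcupP: wC => d; rewrite {1}EC => /imsetP[i _ ->].
  by rewrite eE !inE => /orP[]/eqP->; [exists i | exists (ordS i)].
(* Otherwise [e j] would be a loop. This excludes length one, so the two edges found at [v i] below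
   are distinct. *)
have vS j : v (ordS j) != v j.
  by apply/eqP => Ev; have := card_ends (e j); rewrite eE Ev setUid cards1.
suff ->: [set e in C | v i \in ends e] = [set e i; e (ord_pred i)].
  rewrite cards2 (inj_eq e_inj); case: eqP => // Ei.
  by have := vS (ord_pred i); rewrite ord_predK -Ei eqxx.
apply/setP => x; rewrite !inE EC; apply/andP/idP.
  case=> /imsetP[j _ ->]; rewrite eE !inE !(inj_eq v_inj).
  case/orP=> /eqP->; first by rewrite eqxx.
  by rewrite ordSK eqxx orbT.
by case/orP=> /eqP->; split; rewrite ?imset_f // eE !inE ?ord_predK eqxx ?orbT.
Qed.

End CycleFacts.

(** * Hamiltonian cycles from two perfect matchings *)

Lemma cycle_intro C n (v : 'I_n -> vertex Gm) (e : 'I_n -> edge Gm) :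
    0 < n -> injective v -> injective e -> C = [set e i | i : 'I_n] ->
    (forall i, ends (e i) = [set v i; v (ordS i)]) ->
  is_cycle C.
Proof.
move=> n_gt0 v_inj e_inj EC eE.
have En : n = #|C| by rewrite EC card_imset // card_ord.
move: n_gt0 v_inj e_inj EC eE; rewrite /is_cycle -card_gt0 -{1}En => ->.
move: v e; rewrite {}En => v e v_inj e_inj EC eE.
apply/existsP; exists [ffun i => v i]; apply/existsP; exists [ffun i => e i].
apply/and3P; split; [|apply/eqP|apply/forallP => i; rewrite !ffunE eE //].
  by apply/injectiveP => i j; rewrite !ffunE => /v_inj.
by rewrite {1}EC; apply: eq_imset => i; rewrite ffunE.
Qed.

(* Walking alternately along the two matchings closes up into a cycle; its
   vertex set is saturated, so it is everything. *)
Lemma alternating_hamiltonian M1 M2 (v0 : vertex Gm) :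
    perfect_matching M1 -> perfect_matching M2 -> [disjoint M1 & M2] ->
    cut_connected (M1 :|: M2) ->
  is_hamiltonian_cycle (M1 :|: M2).
Proof.
move=> /matching_mate[f1 [g1 [f1K f1_neq g1M g1E g1U]]].
move=> /matching_mate[f2 [g2 [f2K f2_neq g2M g2E g2U]]] dis conn.
pose f (c : bool) := if c then f1 else f2.
pose g (c : bool) := if c then g1 else g2.
have fK c : involutive (f c) by case: c.
have f_neq c v : f c v != v by case: c => /=.
have gE c v : ends (g c v) = [set v; f c v] by case: c => /=.
have gC c v : g c v \in M1 :|: M2 by case: c; rewrite !inE ?g1M ?g2M ?orbT.
have g_col c v d w : g c v = g d w -> c = d.
  have nM u : (g2 u \in M1) = false by apply: (disjointFl dis); apply: g2M.
  case: c; case: d => //= Eg; first by rewrite -(nM w) -Eg g1M.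
  by rewrite -(nM v) Eg g1M.
(* A state is a vertex with the matching to leave it by; [step] crosses that edge and switches
   matching, while [flip] reverses the direction of travel. *)
pose step (x : vertex Gm * bool) := (f x.2 x.1, ~~ x.2).
pose flip (x : vertex Gm * bool) := (x.1, ~~ x.2).
have step_inj : injective step.
  by case=> [u c] [w d] [] /= + /negb_inj Ec; rewrite Ec => /(inv_inj (fK d)) ->.
have step_flip x : step (flip (step x)) = flip x.
  by case: x => u c; rewrite /step /flip /= negbK; case: c; rewrite /= ?f1K ?f2K.
(* [flip] conjugates [step] to its inverse, so an orbit containing both [x] and
   [flip x] would contain a fixed point of [flip] or of one of the matchings. *)
have no_flip k x : iter k step x <> flip x.
  have [m] := ubnP k; elim: m k x => // m IHm [|[|k]] x ltk.
  - by case: x => u [].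
  - by case: x => u c [] /= /eqP; rewrite (negPf (f_neq c u)).
  rewrite -step_flip iterS => /step_inj; rewrite iterSr; apply: IHm.
  by rewrite -ltnS (leq_trans _ ltk).
pose x0 := (v0, true).
pose n := order step x0.
pose x (i : nat) := iter i step x0.
have xn : x n = x0 by apply: iter_order.
have x_neq i j : x i <> flip (x j).
  have [lij|lji] := leqP j i.
    by rewrite -(subnK lij) /x iterD; apply: no_flip.
  move=> E; have {E} : flip (x i) = x j by rewrite E; case: (x j) => u [].
  by rewrite -(subnK (ltnW lji)) /x iterD => /esym; apply: no_flip.
(* Two states at one vertex are equal or flips of each other, so by [x_neq] the orbit visits no
   vertex twice. *)
have x_fst i j : (x i).1 = (x j).1 -> x i = x j.
  move=> E; have := @x_neq i j; move: E; rewrite /flip.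
  case: (x i) (x j) => u c [w d] /= ->.
  by case: c; case: d => // /(_ erefl).
have x_inj i j : i < n -> j < n -> x i = x j -> i = j.
  move=> ltin ltjn; rewrite /x -(nth_traject step ltin) -(nth_traject step ltjn).
  by move/eqP; rewrite nth_uniq ?size_traject ?orbit_uniq // => /eqP.
have x_ordS (i : 'I_n) : x (ordS i) = x i.+1.
  have := ltn_ord i; rewrite leq_eqVlt => /orP[/eqP Ei|lti].
    by rewrite Ei xn /= Ei modnn.
  by congr x; rewrite /= modn_small.
pose v (i : 'I_n) := (x i).1.
pose e (i : 'I_n) := g (x i).2 (x i).1.
have v_inj : injective v.
  by move=> i j /x_fst /x_inj H; apply/val_inj/H.
have eE i : ends (e i) = [set v i; v (ordS i)].
  by rewrite gE /v x_ordS.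
have e_inj : injective e.
  move=> i j Ee; have Ec : (x i).2 = (x j).2 := g_col _ _ _ _ Ee.
  have: v j \in ends (e i) by rewrite Ee eE !inE eqxx.
  rewrite eE !inE => /orP[]/eqP; first by move/v_inj.
  rewrite /v x_ordS => /x_fst /(congr1 snd) /=; rewrite -Ec.
  by case: (x i).2.
(* Both matching edges at a visited vertex are on the walk: one is the edge it leaves by, the other
   the edge it arrived by. *)
have v_step u : u \in [set v i | i : 'I_n] ->
    forall c, exists i : 'I_n, e i = g c u.
  case/imsetP=> i _ -> c; have [Ec|nEc] := eqVneq c (x i).2.
    by exists i; rewrite /e Ec.
  exists (ord_pred i); rewrite /e.
  have Ex : x i = step (x (ord_pred i)) by rewrite -[in LHS](ord_predK i) x_ordS.
  have Ec : (x (ord_pred i)).2 = c.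
    move: nEc; rewrite Ex /step /=; by case: c; case: (x _).2.
  have vi : v i = f c (x (ord_pred i)).1 by rewrite /v Ex /= Ec.
  rewrite Ec vi; case: (c) => /=.
    by apply: g1U; rewrite ?g1M // g1E !inE eqxx orbT.
  by apply: g2U; rewrite ?g2M // g2E !inE eqxx orbT.
have n0 : 0 < n by apply: order_gt0.
have vT u : u \in [set v i | i : 'I_n].
  case: (conn [set v i | i : 'I_n]) => [|E|->]; last by rewrite inE.
    have sat d w w' : d \in M1 :|: M2 -> w \in ends d -> w' \in ends d ->
        w \in [set v i | i : 'I_n] -> w' \in [set v i | i : 'I_n].
      move=> Cd wd w'd wv; have [c Ed] : exists c, d = g c w.
        by case/setUP: Cd => Md; [exists true; apply: g1U|exists false; apply: g2U].
      have [i Ei] := v_step w wv c.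
      by move: w'd; rewrite Ed -Ei eE !inE => /orP[]/eqP->; apply: imset_f.
    by move=> d w w' Cd wd w'd; apply/idP/idP; [apply: (sat d w) | apply: (sat d w')].
  have: v (Ordinal n0) \in [set v i | i : 'I_n] by apply: imset_f.
  by rewrite E inE.
have EC : M1 :|: M2 = [set e i | i : 'I_n].
  apply/setP => d; apply/idP/imsetP => [Cd|[i _ ->]]; last exact: gC.
  have [w wd] := edge_vertex d.
  have [c Ed] : exists c, d = g c w.
    by case/setUP: Cd => Md; [exists true; apply: g1U|exists false; apply: g2U].
  by have [i Ei] := v_step w (vT w) c; exists i => //; rewrite Ed.
apply/andP; split; first exact: (cycle_intro n0 v_inj e_inj EC eE).
apply/eqP/setP => u; rewrite inE; have /imsetP[i _ ->] := vT u.
by apply/bigcupP; exists (e i); rewrite ?gC // eE !inE eqxx.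
Qed.

(* The hypotheses force at least two vertices of Q into every component of
   (V, C), hence there are at most two components. *)
Lemma saturated_dichotomy C Q K L :
    #|Q| = 4 ->
    (forall J, saturated C J -> ~~ odd #|J :&: Q|) ->
    (forall J, saturated C J -> J :&: Q = set0 -> J = set0) ->
    saturated C K -> saturated C L -> K <> set0 -> K <> setT ->
  [\/ L = set0, L = setT, L = K | L = ~: K].
Proof.
move=> Q4 evenQ meetQ satK satL K0 KT.
have ge2 J : saturated C J -> J <> set0 -> 1 < #|J :&: Q|.
  move=> satJ J0; have := evenQ J satJ.
  have : 0 < #|J :&: Q| by rewrite card_gt0; apply/eqP => /(meetQ _ satJ).
  by case: #|_| => [|[]].
have splitQ J1 J2 : #|J1 :&: Q| = #|J1 :&: J2 :&: Q| + #|J1 :&: ~: J2 :&: Q|.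
  rewrite -(cardsID J2 (J1 :&: Q)); congr (_ + _); apply: eq_card => z;
  by rewrite !inE; case: (z \in J1); case: (z \in J2); case: (z \in Q).
have satKC := saturatedC satK; have satLC := saturatedC satL.
have KC0 : ~: K <> set0 by move=> E; apply: KT; rewrite -(setCK K) E setC0.
have cardQ : #|K :&: Q| + #|~: K :&: Q| = 4.
  by rewrite -Q4 -[in RHS](setTI Q) (splitQ setT K) !setTI.
(* [L] cannot split such a [J]: both pieces would be nonempty and saturated, with at least two
   vertices of [Q] each. *)
have half J : saturated C J -> #|J :&: Q| < 4 ->
    J :&: L = set0 \/ J :&: ~: L = set0.
  move=> satJ; have [->|/eqP J1] := eqVneq (J :&: L) set0; first by left.
  have [->|/eqP J2] := eqVneq (J :&: ~: L) set0; first by right.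
  have := ge2 _ (saturatedI satJ satL) J1.
  have := ge2 _ (saturatedI satJ satLC) J2.
  by rewrite (splitQ J L); do 2![case: #|_| => [|[|?]] //]; rewrite !addSn !addnS.
have K2 := ge2 _ satK K0; have KC2 := ge2 _ satKC KC0.
have ltK : #|K :&: Q| < 4 by rewrite -cardQ -addn1 leq_add2l ltnW.
have ltKC : #|~: K :&: Q| < 4 by rewrite -cardQ -add1n leq_add2r ltnW.
(* Each of [K] and its complement now misses [L] or lies inside it, and the four combinations
   determine [L]. *)
have [/setP h1|/setP h1] := half _ satK ltK;
  have [/setP h2|/setP h2] := half _ satKC ltKC.
- apply: Or41; apply/setP => z; move: (h1 z) (h2 z); rewrite !inE.
  by case: (z \in K).
- apply: Or44; apply/setP => z; move: (h1 z) (h2 z); rewrite !inE.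
  by case: (z \in K); case: (z \in L).
- apply: Or43; apply/setP => z; move: (h1 z) (h2 z); rewrite !inE.
  by case: (z \in K); case: (z \in L).
- apply: Or42; apply/setP => z; move: (h1 z) (h2 z); rewrite !inE.
  by case: (z \in K); case: (z \in L).
Qed.

End Graph.

(** * Quadrilaterals of a combinatorial map *)

Section Map.

Variables (Gm : multigraph) (R G B : {set edge Gm}).
Hypothesis mapRGB : combinatorial_map R G B.
Implicit Types (C q : {set edge Gm}) (K : {set vertex Gm}).

Notation quads := (quadrilaterals R G).
Notation green := (green_quadrilaterals R G).

Let pmR : perfect_matching R. Proof. by case: mapRGB => _ _ []. Qed.
Let pmG : perfect_matching G. Proof. by case: mapRGB => _ _ []. Qed.
Let pmB : perfect_matching B. Proof. by case: mapRGB => _ _ []. Qed.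
Let disRG : [disjoint R & G]. Proof. by case: mapRGB => _ []. Qed.

Lemma map_colour e : (e \notin B) = (e \in R :|: G).
Proof.
case: mapRGB => _ [cov _ dRB dGB] _ _.
have := in_setT e; rewrite -cov !inE.
case: (boolP (e \in B)) => eB /=; last by rewrite orbF => ->.
by rewrite (disjointFl dRB) // (disjointFl dGB).
Qed.

Lemma quad_sub q : q \in quads -> q \subset R :|: G.
Proof. by rewrite inE => /and3P[]. Qed.

Lemma green_nonquad C q : q \notin quads -> (q \in green C) = false.
Proof. by move=> /negPf nE; rewrite [LHS]in_set nE. Qed.

Lemma quad_cycle q : q \in quads -> is_cycle q.
Proof. by rewrite inE => /and3P[]. Qed.

Lemma quad_card q : q \in quads -> #|vertices_of q| = 4.
Proof.
by rewrite inE => /and3P[_ cq /eqP <-]; apply: cycle_vertices_card.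
Qed.

Lemma quad_nonblack q e : q \in quads -> e \in q -> e \notin B.
Proof. by move=> /quad_sub/subsetP sq /sq; rewrite -map_colour. Qed.

Lemma quad_disjoint q q' e :
  q \in quads -> q' \in quads -> e \in q -> (e \in q') = (q' == q).
Proof.
move=> Eq Eq' eq; have [->//|neq] := eqVneq q' q; apply/negP => eq'.
have [v ve] := edge_vertex e.
have [_ _ _ [_ /(_ _ _ Eq' Eq neq) dis]] := mapRGB.
suff: v \in vertices_of q
    by rewrite (disjointFr dis) //; apply/bigcupP; exists e.
by apply/bigcupP; exists e.
Qed.

Lemma quad_of e : e \in R :|: G -> exists2 q, q \in quads & e \in q.
Proof. by have [_ _ _ [<- _]] := mapRGB => /bigcupP. Qed.

(** The left side is contained in the right one; it has two elements because [q] is a cycle, and the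
    right side has at most two, one per colour. *)
Lemma quad_star q v : q \in quads -> v \in vertices_of q ->
  [set e in q | v \in ends e] = [set e in R :|: G | v \in ends e].
Proof.
move=> Eq vq; apply/eqP; rewrite eqEcard (cycle_degree (quad_cycle Eq) vq).
apply/andP; split.
  apply/subsetP=> e; rewrite !inE => /andP[/(subsetP (quad_sub Eq)) + ->].
  by rewrite inE andbT.
rewrite (_ : [set e in _ | _] =
  [set e in R | v \in ends e] :|: [set e in G | v \in ends e]).
  by rewrite (leq_trans (leq_card_setU _ _)) // pmR pmG.
by apply/setP => e; rewrite !inE andb_orl.
Qed.

Lemma quad_starP q v e : q \in quads -> v \in vertices_of q -> v \in ends e ->
  (e \in q) = (e \in R :|: G).
Proof.
by move=> Eq vq ve; have /setP/(_ e) := quad_star Eq vq; rewrite !inE ve !andbT.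
Qed.

Lemma vertices_ofP q v e : e \in q -> v \in ends e -> v \in vertices_of q.
Proof. by move=> eq ve; apply/bigcupP; exists e. Qed.

Lemma matching_edge M (v : vertex Gm) : perfect_matching M ->
  exists2 e, (e \in M) && (v \in ends e) &
    forall e', e' \in M -> v \in ends e' -> e' = e.
Proof.
move=> /(_ v)/eqP/cards1P[e /setP Ee]; exists e.
  by move: (Ee e); rewrite !inE eqxx => ->.
by move=> e' e'M ve'; apply/eqP; move: (Ee e'); rewrite !inE e'M ve' => <-.
Qed.

(** * Fully black 2-regular subgraphs and colour exchange *)

(** Encodes a fully black 2-regular spanning subgraph: one black and one other edge at each
    vertex. *)
Definition black_factor C := B \subset C /\ perfect_matching (C :\: B).

Lemma hamiltonian_black_factor C :
  is_hamiltonian_cycle C -> B \subset C -> black_factor C /\ cut_connected C.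
Proof.
case/andP => cycC /eqP VC sBC; split; last first.
  move=> K satK; have [->|[v vK]] := set_0Vmem K; [by left | right].
  by apply/setP => u; rewrite inE (cycle_connected cycC satK (y := v)) ?VC ?inE.
split=> // v; have := @cycle_degree _ _ cycC v; rewrite VC inE => /(_ isT).
rewrite -(cardsID B) (_ : _ :&: B = [set e in B | v \in ends e]) ?pmB => [[<-]|].
  by apply: eq_card => e; rewrite !inE andbA.
apply/setP => e; rewrite !inE andbAC; case eB : (e \in B); rewrite ?andbF //.
by rewrite (subsetP sBC).
Qed.

(** [C] is the disjoint union of the matchings [B] and [C :\: B]; the alternating walk starts at
    [v0]. *)
Lemma black_factor_hamiltonian C (v0 : vertex Gm) :
  black_factor C -> cut_connected C -> is_hamiltonian_cycle C.
Proof.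
move=> [sBC pmC]; have := setID C B; rewrite (setIidPr sBC) => <-.
apply: alternating_hamiltonian => //.
by apply/pred0P => e; rewrite !inE; case: (e \in B).
Qed.

(* Around a quadrilateral, red edges outside C and green edges inside C
   propagate the choice of colour made by C at a single vertex. *)
Lemma mem_black_factor C q e : black_factor C -> q \in quads -> e \in q ->
  (e \in C) = ((e \in G) == (q \in green C)).
Proof.
move=> [sBC pmC] Eq eq.
(* The vertices whose green edge lies in [C]. As [C] has exactly one nonblack edge at each vertex,
   they are also those whose red edge avoids [C]. *)
pose S := [set v | [exists d in G, (v \in ends d) && (d \in C)]].
have SG u d : d \in G -> u \in ends d -> (u \in S) = (d \in C).
  move=> dG ud; rewrite inE; apply/exists_inP/idP => [[c cG /andP[uc cC]]|dC].
    by have [g _ gU] := matching_edge u pmG; rewrite (gU d) // -(gU c).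
  by exists d; rewrite ?ud.
have SR u r : r \in R -> u \in ends r -> (u \in S) = (r \notin C).
  move=> rR ur; have [d /andP[dG ud] _] := matching_edge u pmG.
  have [c /andP[cM uc] cU] := matching_edge u pmC.
  have rB : r \notin B by rewrite map_colour inE rR.
  have dB : d \notin B by rewrite map_colour inE dG orbT.
  rewrite (SG u d) //; apply/idP/idP => [dC|rC].
    apply/negP => rC; have Er : r = c by apply: cU; rewrite // inE rB.
    have Ed : d = c by apply: cU; rewrite // inE dB.
    by rewrite Er -Ed (disjointFl disRG) in rR.
  move: (cM); rewrite inE map_colour => /andP[/setUP[cR|cG] cC].
    have [r' _ rU] := matching_edge u pmR.
    have Erc : r = c by rewrite [RHS]rU //; apply: rU.
    by rewrite Erc cC in rC.
  have [g _ gU] := matching_edge u pmG.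
  by have -> : d = c by rewrite [RHS]gU //; apply: gU.
have satS : saturated q S.
  move=> d u w dq ud wd; have := subsetP (quad_sub Eq) d dq.
  by case/setUP=> Hd; [rewrite !(SR _ d) | rewrite !(SG _ d)].
have conS := cycle_connected (quad_cycle Eq) satS.
have SE v : v \in vertices_of q -> (v \in S) = (q \in green C).
  move=> vq; rewrite [RHS]inE Eq /=; apply/idP/subsetP => [vS d|sC].
    case/setIP=> dq dG; have [u ud] := edge_vertex d.
    by rewrite -(SG u d) // (conS u v) // (vertices_ofP dq).
  have [d /andP[dG vd] _] := matching_edge v pmG.
  by rewrite (SG v d) // sC // inE dG (quad_starP Eq vq vd) inE dG orbT.
have [u ue] := edge_vertex e.
rewrite -(SE u (vertices_ofP eq ue)).
case/setUP: (subsetP (quad_sub Eq) e eq) => [eR|eG].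
  by rewrite (disjointFr disRG) // (SR u e) //; case: (e \in C).
by rewrite eG (SG u e) //; case: (e \in C).
Qed.

(** At a vertex of [q] both nonblack edges lie in [q] and one of them in [C]; the exchange swaps
    them. Other vertices see no change. *)
Lemma flip_black_factor C q :
  q \in quads -> black_factor C -> black_factor (symdiff C q).
Proof.
move=> Eq [sBC pmC]; split=> [|v].
  apply/subsetP => e eB; rewrite mem_symdiff (subsetP sBC) //=.
  by apply/negP => /(quad_nonblack Eq); rewrite eB.
have EC : symdiff C q :\: B = symdiff (C :\: B) q.
  apply/setP => e; rewrite inE !mem_symdiff inE.
  case eB: (e \in B) => //=; apply/esym/negP => /(quad_nonblack Eq).
  by rewrite eB.
have [vq|vq] := boolP (v \in vertices_of q); last first.
  rewrite EC -(pmC v); apply: eq_card => e; rewrite inE mem_symdiff [in RHS]inE.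
  case ve: (v \in ends e); rewrite ?andbF // !andbT.
  suff -> : (e \in q) = false by rewrite addbF.
  by apply: contraNF vq => eq; apply: vertices_ofP ve.
have deg := cycle_degree (quad_cycle Eq) vq.
rewrite EC (_ : [set e in _ | _] =
    [set e in q | v \in ends e] :\: [set e in C :\: B | v \in ends e]).
  rewrite cardsD deg (setIidPr _) ?pmC //.
  rewrite (quad_star Eq vq); apply/subsetP => e.
  by rewrite !in_set -in_setU -map_colour => /andP[/andP[-> _] ->].
apply/setP => e; rewrite inE mem_symdiff 4!inE.
case ve: (v \in ends e); rewrite ?andbF //= !andbT.
rewrite (quad_starP Eq vq ve) -map_colour in_setD.
by case: (e \in B); case: (e \in C).
Qed.

Lemma green_flip C q : q \in quads -> black_factor C ->
  green (symdiff C q) = symdiff (green C) [set q].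
Proof.
move=> Eq bC; apply/setP => q'; rewrite mem_symdiff in_set1.
have [Eq'|] := boolP (q' \in quads); last first.
  by move=> nE; rewrite !green_nonquad //; case: eqP nE => // ->; rewrite Eq.
have [v vq'] : exists v, v \in vertices_of q'.
  by apply/set0Pn; rewrite -card_gt0 (quad_card Eq').
(* By [mem_black_factor] a single green edge of [q'] decides its colour, and the exchange affects
   that edge only when [q'] is [q]. *)
have [e /andP[eG ve] _] := matching_edge v pmG.
have eq' : e \in q' by rewrite (quad_starP Eq' vq' ve) inE eG orbT.
have := mem_black_factor (flip_black_factor Eq bC) Eq' eq'.
have := mem_black_factor bC Eq' eq'.
rewrite eG mem_symdiff (quad_disjoint Eq' Eq eq') (eq_sym q).
by case: (e \in C); case: (q' \in green C); case: (q' \in green _); case: eqP.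
Qed.

Lemma saturated_even C q K : black_factor C -> q \in quads ->
  saturated (C :\: q) K -> ~~ odd #|K :&: vertices_of q|.
Proof.
move=> [sBC pmC] Eq satK.
have evK : ~~ odd #|K|.
  apply: (matching_even pmB) => v e eB ve vK w we.
  rewrite -(satK e v w) // inE (subsetP sBC) // andbT.
  by apply/negP => /(quad_nonblack Eq); rewrite eB.
have := evK; rewrite -(cardsID (vertices_of q) K) oddD.
suff /negPf-> : ~~ odd #|K :\: vertices_of q| by rewrite addbF.
(* A nonblack edge with one end off [q] has both ends off [q], since [q] contains every red or green
   edge at its vertices. *)
apply: (matching_even pmC) => v e; rewrite inE => /andP[eB eC] ve.
rewrite !inE => /andP[vq vK] w we.
have eq : e \notin q by apply: contra vq => eq; apply: vertices_ofP ve.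
rewrite in_setD -(satK e v w) ?vK ?inE ?eq ?eC // andbT.
by apply: contra eq => wq; rewrite (quad_starP Eq wq we) -map_colour.
Qed.

(** The edges of [q] have both ends outside [K], so restoring them breaks nothing. *)
Lemma saturated_off_quad C q K : saturated (C :\: q) K ->
  K :&: vertices_of q = set0 -> saturated C K.
Proof.
move=> satK /setP K0 e u v eC ue ve.
have [eq|eq] := boolP (e \in q); last by apply: (satK e); rewrite ?inE ?eq.
move: (K0 u) (K0 v).
by rewrite !inE !(vertices_ofP eq) // !andbT => -> ->.
Qed.

(** The dichotomy is applied to [C :\: q], which lies in the exchanged graph. A saturated set
    missing [q] would be saturated for the connected [C], hence empty. *)
Lemma flip_two_components C q K L : black_factor C -> cut_connected C ->
    q \in quads -> saturated (symdiff C q) K -> saturated (symdiff C q) L ->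
    K <> set0 -> K <> setT ->
  [\/ L = set0, L = setT, L = K | L = ~: K].
Proof.
move=> bC conC Eq satK satL.
have sub : C :\: q \subset symdiff C q by apply: subsetUl.
apply: (saturated_dichotomy (C := C :\: q) (quad_card Eq)).
- by move=> J; apply: saturated_even.
- move=> J satJ J0; have [//|JT] := conC J (saturated_off_quad satJ J0).
  by have := quad_card Eq; rewrite -[vertices_of q]setTI -JT J0 cards0.
- exact: saturated_sub satK.
- exact: saturated_sub satL.
Qed.

(** By the dichotomy for [C :\: q] only [K] and its complement could still separate. Then [K] would
    be saturated for [q], each edge of which lies in [C] or in the exchanged graph; but the cycle
    [q] meets both sides. *)
Lemma flip_merge C q K : black_factor C -> q \in quads ->
    saturated C K ->
    (forall L, saturated C L -> [\/ L = set0, L = setT, L = K | L = ~: K]) ->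
    K :&: vertices_of q <> set0 -> ~: K :&: vertices_of q <> set0 ->
  cut_connected (symdiff C q).
Proof.
move=> bC Eq satK two Kq KCq L satL.
have KT : K <> setT by move=> E; apply: KCq; rewrite E setCT set0I.
have K0 : K <> set0 by move=> E; apply: Kq; rewrite E set0I.
have nsatK : ~ saturated (symdiff C q) K.
  move=> satK'; have satq : saturated q K.
    apply: (saturated_sub _ (saturatedU satK satK')); apply/subsetP => e eq.
    by rewrite inE mem_symdiff eq; case: (e \in C).
  have con := cycle_connected (quad_cycle Eq) satq.
  have /set0Pn[u /setIP[uK uq]] := introN eqP Kq.
  have /set0Pn[v /setIP[vK vq]] := introN eqP KCq.
  by move: vK; rewrite inE -(con u v) ?uK.
have : [\/ L = set0, L = setT, L = K | L = ~: K].
  apply: (saturated_dichotomy (C := C :\: q) (quad_card Eq)) => //.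
  - by move=> J; apply: saturated_even.
  - move=> J satJ J0; have := J0.
    case: (two J (saturated_off_quad satJ J0)) => -> //; rewrite setTI => E.
    by have := quad_card Eq; rewrite E cards0.
  - by apply: saturated_sub satK; apply: subsetDl.
  - by apply: saturated_sub satL; apply: subsetUl.
case=> EL; [by left | by right | |]; case: nsatK.
  by rewrite -EL.
by rewrite -(setCK K) -EL; apply: saturatedC.
Qed.

Lemma map_feasibleP F : reflect
  (exists C, [/\ black_factor C, cut_connected C, F = green C &
     is_hamiltonian_cycle C])
  (F \in map_feasible R G B).
Proof.
rewrite inE; apply: (iffP andP) => [[_ /existsP[C /and3P[hC sB /eqP EF]]]|].
  by have [bC conC] := hamiltonian_black_factor hC sB; exists C.
case=> C [[sB pmC] conC -> hC]; split.
  by apply/subsetP => q; rewrite inE => /andP[].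
by apply/existsP; exists C; rewrite hC /fully_black sB eqxx.
Qed.

(** * The symmetric exchange axiom *)

Lemma map_exchange (F1 F2 : {set {set edge Gm}}) :
  F1 \in map_feasible R G B -> F2 \in map_feasible R G B ->
  forall x, x \in symdiff F1 F2 ->
  exists2 y, y \in symdiff F1 F2 & symdiff F1 [set x; y] \in map_feasible R G B.
Proof.
move=> /map_feasibleP[C1 [b1 con1 EF1 _]] /map_feasibleP[C2 [b2 con2 EF2 _]] x xF.
have quadF q : q \in symdiff F1 F2 -> q \in quads.
  by apply: contraTT => nE; rewrite mem_symdiff EF1 EF2 !green_nonquad.
have Ex := quadF x xF.
have [v0 v0x] : exists v, v \in vertices_of x.
  by apply/set0Pn; rewrite -card_gt0 (quad_card Ex).
have bH := flip_black_factor Ex b1; set H := symdiff C1 x in bH.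
have [conH|[K [satK K0 KT]]] := cut_connectedVcut H.
  exists x => //; apply/map_feasibleP; exists H; split=> //.
    by rewrite setUid /H green_flip // EF1.
  exact: black_factor_hamiltonian.
have two L (satL : saturated H L) := flip_two_components b1 con1 Ex satK satL K0 KT.
have [y yF /andP[/eqP Ky /eqP KCy]] : exists2 y, y \in symdiff F1 F2 :\ x &
    (K :&: vertices_of y != set0) && (~: K :&: vertices_of y != set0).
  apply/exists_inP; apply: contra_notT K0 => /exists_inPn nocross.
  suff satK2 : saturated C2 K by case: (con2 K satK2) => // /KT.
  suff sub e u v : e \in C2 -> u \in ends e -> v \in ends e ->
      u \in K -> v \in K.
    by move=> e u v eC ue ve; apply/idP/idP; [apply: (sub e)|apply: (sub e)].
  move=> eC2 ue ve uK; have inH : e \in H -> v \in K.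
    by move=> eH; rewrite -(satK e u v).
  have [eB|] := boolP (e \in B); first by apply: inH; case: bH => /subsetP->.
  rewrite map_colour => /quad_of[q Eq eq].
  have e1 := mem_black_factor b1 Eq eq; have e2 := mem_black_factor b2 Eq eq.
  have qF : (q \in symdiff F1 F2) = (e \in C1) (+) (e \in C2).
    rewrite mem_symdiff EF1 EF2 e1 e2.
    by case: (e \in G); case: (q \in green C1); case: (q \in green C2).
  have eH : (e \in H) = (e \in C1) (+) (x == q).
    by rewrite mem_symdiff (quad_disjoint Eq Ex eq).
  rewrite eC2 addbT in qF.
  (* On [x] the exchange makes [H] agree with [C2]. Off [x], either the two cycles agree on [q], so
     [e] is in [H], or [nocross] keeps [q] on one side of [K]. *)
  have [Eqx|nqx] := eqVneq x q.
    by apply: inH; rewrite eH Eqx eqxx addbT -qF -Eqx.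
  have [qF'|qF'] := boolP (q \in symdiff F1 F2); last first.
    by apply: inH; rewrite eH (negPf nqx) addbF -[_ \in _]negbK -qF.
  have qFx : q \in symdiff F1 F2 :\ x by rewrite in_setD1 eq_sym nqx.
  have := nocross q qFx; rewrite negb_and negbK => /orP[/eqP/setP/(_ u)|].
    by rewrite !inE uK (vertices_ofP eq ue).
  rewrite negbK => /eqP/setP/(_ v); rewrite !inE (vertices_ofP eq ve) andbT.
  by move/negbFE.
case/setD1P: yF => y_x yF; have Ey := quadF y yF; exists y => //.
have bHy := flip_black_factor Ey bH.
have conHy := flip_merge bH Ey satK two Ky KCy.
apply/map_feasibleP; exists (symdiff H y); split=> //.
  (* As [y] differs from [x], exchanging in [x] and then in [y] amounts to the symmetric difference
     with [[set x; y]]. *)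
  rewrite !green_flip // -EF1; apply/setP => z; rewrite !mem_symdiff !inE.
  by case: (eqVneq z x) => [->|_]; rewrite ?addbF // eq_sym (negPf y_x) addbF.
exact: black_factor_hamiltonian.
Qed.

End Map.

Theorem theorem2p1 (Gm : multigraph) (R G B : {set edge Gm}) :
  combinatorial_map R G B ->
  delta_matroid (quadrilaterals R G) (map_feasible R G B).
Proof.
move=> mapRGB; split; last exact: map_exchange.
by apply/subsetP => F; rewrite powersetE inE => /andP[].
Qed.
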